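(* For any $\epsilon>0$, there exists $E\subseteq\mathbb{Z}^2$ such that for all $(u,v)\in(-\epsilon,\epsilon)\times(-\epsilon,\epsilon)$, \[D(E\cap t_{u,v})=D(E)=1.\]
   Context: For a $1$-separated set $E\subset\mathbb{R}^2$ (in particular for any $E\subseteq\mathbb{Z}^2$), the counting dimension $D(E)$ is \[D(E)=\limsup_{\|C\|\to\infty}\frac{\log|E\cap C|}{\log\|C\|},\] where $C\subset\mathbb{R}^2$ ranges over arbitrary squares (placed anywhere in the plane) with sides parallel to the coordinate axes, $\|C\|$ is the side length of $C$, and the limsup means $\lim_{R\to\infty}\sup_{\|C\|\ge R}$. For $u,v\in\mathbb{R}$ with $u\neq0$, the width-1 tube $t_{u,v}$ is \[t_{u,v}=\Big\{(x,y)\in\mathbb{R}^2 : -\tfrac1u x+v\sqrt{1+\tfrac1{u^2}}<y\le-\tfrac1u x+(v+1)\sqrt{1+\tfrac1{u^2}}\Big\}.\] The line through the origin perpendicular to it has slope $u$. For $u=0$, $t_{0,v}=\{(x,y)\in\mathbb{R}^2: v<x\le v+1\}$ (vertical tube). *)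

(* Defs.v *)
(* MathComp-Analysis. *)
From HB Require Import structures.
From mathcomp Require Export all_boot all_order all_algebra.
From mathcomp Require Export all_classical all_reals all_analysis.

Set Implicit Arguments.
Unset Strict Implicit.
Unset Printing Implicit Defensive.
Import Order.TTheory GRing.Theory Num.Theory numFieldNormedType.Exports.

Local Open Scope classical_set_scope.
Local Open Scope ring_scope.

Section CountingDimension.
Variable R : realType.
Implicit Types (E : set (R * R)) (a b r s u v : R).

Definition Zsq : set (R * R) :=
  range (fun p : int * int => (p.1%:~R, p.2%:~R)).

Definition square a b s : set (R * R) :=
  [set p | a <= p.1 <= a + s /\ b <= p.2 <= b + s].

(* log |E `&` C| / log ||C|| for C = square a b s, in \bar R: it is -oo when
   s > 1 and C misses E (log 0 = -oo), and +oo when s > 1 and E `&` C is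
   infinite. *)
Definition log_count_ratio E a b s : \bar R :=
  (lne (counting (E `&` square a b s)) / (ln s)%:E)%E.

Definition sup_log_count_ratio E r : \bar R :=
  ereal_sup [set log_count_ratio E c.1.1 c.1.2 c.2
            | c in [set c : R * R * R | r <= c.2]].

(* The limit always exists: the supremum is nonincreasing in r. *)
Definition counting_dim E : \bar R :=
  lim (sup_log_count_ratio E r @[r --> +oo%R]).

Definition tube u v : set (R * R) :=
  if u == 0 then [set p | v < p.1 <= v + 1]
  else [set p | - (1 / u) * p.1 + v * Num.sqrt (1 + 1 / u ^+ 2) < p.2
                <= - (1 / u) * p.1 + (v + 1) * Num.sqrt (1 + 1 / u ^+ 2)].

End CountingDimension.

Arguments Zsq : clear implicits.

(* Main.v *)
(* E consists of the lattice points (x, j), j >= 0, lying within a fixed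
   distance W of the slowly oscillating curve x = - eps j sin (ln (ln j)).
   Each row of E has boundedly many points, so a square of side s contains O(s)
   points of E.  Over n rows starting at height t, the slope eps sin (ln (ln j))
   varies by at most eps n / (t ln t), so it shifts the curve horizontally by
   O(1) as soon as ln t >= n; it takes every value u of (-eps, eps) at
   arbitrarily large heights.  Hence there are n consecutive rows in which E
   contains the points of the tube t_{u,v}, and each of these rows meets the
   tube in a lattice point because a horizontal section of the tube has length
   at least 1. *)
Require Import Defs.
From mathcomp Require Import ring lra.

Set Implicit Arguments.
Unset Strict Implicit.

Import Order.TTheory GRing.Theory Num.Theory numFieldNormedType.Exports.
Local Open Scope classical_set_scope.
Local Open Scope ring_scope.
Local Open Scope card_scope.

(** * Bounds on [counting] from cardinal comparisons *)

Lemma counting_le (R : realType) (T : choiceType) (A : set T) (n : nat) :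
  A #<= `I_n -> (counting A <= (n%:R : R)%:E)%E.
Proof.
move=> An; have finA : finite_set A by apply/finite_set_leP; exists n.
by rewrite /counting asboolT// lee_fin ler_nat geq_card_fset_set.
Qed.

Lemma counting_ge (R : realType) (T : choiceType) (A : set T) (n : nat) :
  `I_n #<= A -> ((n%:R : R)%:E <= counting A)%E.
Proof.
move=> An; rewrite /counting; case: asboolP => [finA|_]; last by rewrite leey.
by rewrite lee_fin ler_nat leq_card_fset_set.
Qed.

(** * Slow oscillation of [sin (ln (ln j))] *)

Lemma sin_lipschitz (R : realType) (x y : R) : `|sin y - sin x| <= `|y - x|.
Proof.
wlog xy : x y / x <= y.
  move=> H; have [/H//|/ltW/H] := leP x y.
  by rewrite distrC (distrC x).
have [|c _ ->] := @MVT_segment R sin cos x y xy (fun z _ => is_derive_sin z).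
  by apply: continuous_subspaceT => z; exact: continuous_sin.
by rewrite normrM ler_piMl// ler_norml cos_geN1 cos_le1.
Qed.

Lemma ln_diff_le (R : realType) (x y : R) : 0 < x -> x <= y ->
  ln y - ln x <= (y - x) / x.
Proof.
move=> x0 xy; have y0 := lt_le_trans x0 xy.
rewrite -ln_div ?posrE//.
have -> : y / x = 1 + (y - x) / x by field; rewrite gt_eqF.
apply: le_ln1Dx; have : 0 <= (y - x) / x by rewrite divr_ge0 ?subr_ge0// ltW.
lra.
Qed.

(** Take [p] large with [eps * sin p = u], and [L = expR p], [t = expR L]. Past [t], [ln (ln j)]
    exceeds [p] by at most [(j - t) / (t * L)], hence by at most [1 / t] once [j - t <= n.+1 <= L];
    the factor [j * eps <= 2 * t * eps] turns this into [2 * eps]. *)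
Lemma slow_sin_near (R : realType) (eps u : R) (n : nat) :
  - eps < u < eps ->
  exists m : nat, forall j : nat, (m <= j <= m + n)%N ->
    `|j%:R * (eps * sin (ln (ln j%:R))) - j%:R * u| <= 2 * eps.
Proof.
move=> /andP[u1 u2]; have eps0 : 0 < eps by lra.
pose phi := asin (u / eps).
have sinphi : eps * sin phi = u.
  rewrite asinK; first by field; rewrite gt_eqF.
  by rewrite in_itv/= ler_pdivrMr// ler_pdivlMr// mul1r mulN1r !ltW.
(* Enough full periods are added to [phi] to push it beyond [n.+1]. *)
pose k := (Num.truncn ((n.+1%:R - phi) / (pi *+ 2))).+1.
have kP : n.+1%:R < phi + (pi *+ 2) *+ k.
  have pi2 : (0 : R) < pi *+ 2 by rewrite mulrn_wgt0// pi_gt0.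
  have := truncnS_gt ((n.+1%:R - phi) / (pi *+ 2)).
  by rewrite ltr_pdivrMr// ltrBlDl mulr_natl.
set p := phi + _ in kP.
pose L := expR p; pose t := expR L.
have L1 : n.+1%:R <= L by have := expR_ge1Dx p; rewrite /L; lra.
have n1 : (1 : R) <= n.+1%:R by rewrite ler1n.
have tL : L <= t by have := expR_ge1Dx L; rewrite /t; lra.
exists (Num.truncn t).+1 => j /andP[mj jm].
have tj : t <= j%:R.
  by apply: ltW; apply: lt_le_trans (truncnS_gt t) _; rewrite ler_nat.
have jt : j%:R <= t + n.+1%:R.
  have : (Num.truncn t)%:R <= t by rewrite truncn_le; lra.
  move: jm; rewrite addSnnS -(ler_nat R) natrD; lra.
have lnt : ln t = L by rewrite expRK.
have lnL : ln L = p by rewrite expRK.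
have L0 : 0 < L by lra.
have t0 : 0 < t by lra.
have j0 : 0 < j%:R :> R by lra.
have h1 := ln_diff_le t0 tj; rewrite lnt in h1.
have Llj : L <= ln j%:R by rewrite -lnt ler_ln ?posrE.
have h2 := ln_diff_le L0 Llj; rewrite lnL in h2.
have h2' : p <= ln (ln j%:R) by rewrite -lnL ler_ln ?posrE//; lra.
have sp : sin p = sin phi by rewrite /p periodicn//; exact: sinD2pi.
rewrite -sinphi -sp -mulrBr -mulrBr !normrM (gtr0_norm j0) (gtr0_norm eps0).
have h3 := sin_lipschitz p (ln (ln j%:R)).
have h4 : `|sin (ln (ln j%:R)) - sin p| <= (j%:R - t) / t / L.
  apply: (le_trans h3); rewrite ger0_norm ?subr_ge0//; apply: (le_trans h2).
  by rewrite ler_pM2r ?invr_gt0.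
have h5 : (j%:R - t) / t / L <= t^-1.
  rewrite ler_pdivrMr// ler_pdivrMr// mulrAC mulVf ?gt_eqF// mul1r; lra.
have h6 : `|sin (ln (ln j%:R)) - sin p| <= t^-1 by exact: le_trans h4 h5.
have h7 : j%:R / t <= 2 by rewrite ler_pdivrMr//; lra.
rewrite mulrCA [leRHS]mulrC ler_pM2l//; apply: le_trans h7.
by rewrite ler_pM2l.
Qed.

(** * Lattice points of a tube, row by row *)

(** The section of the tube at height [y] is a half-open interval of length [sqrt (1 + u ^ 2) >= 1],
    so it contains an integer. All of it lies within [(|v| + 1) * sqrt (1 + u ^ 2)] of [- y * u],
    and the root is at most [1 + |u|]. *)
Lemma tube_int_row (R : realType) (u v y : R) :
  exists x : int, tube u v (x%:~R, y) /\
    `|x%:~R + y * u| <= (`|v| + 1) * (1 + `|u|).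
Proof.
have [u0|u0] := eqVneq u 0.
  exists (Num.floor (v + 1)); rewrite /tube u0 eqxx/= normr0 mulr0 !addr0 mulr1.
  have /andP[] := floor_itv (v + 1); rewrite intrD mulr1z => h1 h2.
  split; first by rewrite h1 andbT; lra.
  have := ler_norm v; have := ler_norm (- v); rewrite normrN ler_norml; lra.
pose q := Num.sqrt (1 + u ^+ 2).
have q0 : 0 <= q by exact: sqrtr_ge0.
have q2 : q ^+ 2 = 1 + u ^+ 2 by rewrite sqr_sqrtr// addr_ge0// sqr_ge0.
have q1 : 1 <= q by rewrite -(@ler_pXn2r _ 2)// ?nnegrE// q2 expr1n lerDl sqr_ge0.
have qu : q <= 1 + `|u|.
  rewrite -(@ler_pXn2r _ 2)// ?nnegrE ?addr_ge0// q2 sqrrD real_normK ?num_real//.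
  by rewrite expr1n mul1r lerD2r lerDl mulrn_wge0.
have bnd (w : R) : `|w| <= (`|v| + 1) * q -> `|w| <= (`|v| + 1) * (1 + `|u|).
  by move=> h; apply: le_trans h _; rewrite ler_wpM2l// addr_ge0.
have vq1 : v * q <= `|v| * q by rewrite ler_wpM2r// ler_norm.
have vq2 : - (v * q) <= `|v| * q by rewrite -mulNr ler_wpM2r// -normrN ler_norm.
rewrite /tube (negbTE u0)/=.
have -> : Num.sqrt (1 + 1 / u ^+ 2) = q / `|u|.
  rewrite -(sqrtr_sqr u) -sqrtrV ?sqr_ge0// /q -sqrtrM ?addr_ge0 ?sqr_ge0//.
  by congr Num.sqrt; field.
(* The section is closed on the left for [u < 0] and on the right for [u > 0]; the integer is
   obtained by rounding its closed end inwards. *)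
move: u0; rewrite neq_lt => /orP[u0|u0].
- exists (Num.ceil (- (v + 1) * q - y * u)).
  set x := Num.ceil _.
  have : (x - 1)%:~R < - (v + 1) * q - y * u <= x%:~R by exact: ceil_itv.
  rewrite intrB mulr1z => /andP[h1 h2].
  split; last by apply: bnd; rewrite ler_norml; lra.
  rewrite ltr0_norm//.
  have E (w : R) : - (1 / u) * x%:~R + w * (q / - u) = (x%:~R + w * q) / - u.
    by field; rewrite lt_eqF.
  rewrite !E ltr_pdivrMr ?oppr_gt0// ler_pdivlMr ?oppr_gt0//.
  by apply/andP; split; lra.
- exists (Num.floor ((v + 1) * q - y * u)).
  set x := Num.floor _.
  have : x%:~R <= (v + 1) * q - y * u < (x + 1)%:~R by exact: floor_itv.
  rewrite intrD mulr1z => /andP[h1 h2].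
  split; last by apply: bnd; rewrite ler_norml; lra.
  rewrite gtr0_norm//.
  have E (w : R) : - (1 / u) * x%:~R + w * (q / u) = (w * q - x%:~R) / u.
    by field; rewrite gt_eqF.
  by rewrite !E ltr_pdivrMr// ler_pdivlMr//; apply/andP; split; lra.
Qed.

(** * Bands around a curve and their linear growth *)

(** The curve is [x = - c j]: the sign makes [c j] equal to [j] times the slope [u] of the tubes
    that it follows. *)
Definition band (R : realType) (c : nat -> R) (W : R) : set (R * R) :=
  [set p | exists x : int, exists j : nat,
    p = (x%:~R, j%:R) /\ `|x%:~R + c j| <= W].

Lemma band_Zsq (R : realType) (c : nat -> R) (W : R) : band c W `<=` Zsq R.
Proof. by move=> _ [x [j [-> _]]]; exists (x, j%:Z). Qed.

Lemma card_band_square (R : realType) (c : nat -> R) (W a b s : R) :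
  band c W `&` square a b s #<=
    `I_((Num.truncn s).+2 * (Num.truncn (2 * W)).+1).
Proof.
set M := (Num.truncn (2 * W)).+1.
pose z j := Num.ceil (- c j - W).
(* The quotient of [k] by [M] selects the row and the remainder the offset from [z j], the leftmost
   integer of the band there. For negative [b], [truncn b] is 0, which is the first row of the
   band. *)
pose f k : R * R := let j := (Num.truncn b + k %/ M)%N in
  ((z j + (k %% M)%N%:Z)%:~R, j%:R).
apply: card_le_trans (card_image_le f _).
apply: subset_card_le => _ [[x [j [-> xW]]] [_ /= /andP[bj js]]].
have bj' : (Num.truncn b <= j)%N.
  by rewrite truncn_le_nat; apply: le_lt_trans bj _; rewrite ltr_nat.
have jN : (j - Num.truncn b < (Num.truncn s).+2)%N.
  rewrite ltn_subLR// -(ltr_nat R) natrD -natr1.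
  have := truncnS_gt b; have := truncnS_gt s; rewrite -!natr1; lra.
move: xW; rewrite ler_norml => /andP[xW1 xW2].
have zx : z j <= x by rewrite /z ceil_le_int; lra.
have xzM : (`|x - z j| < M)%N.
  rewrite -(ltr_nat R) -[X in X < _]/((`|x - z j|%N : int)%:~R) gez0_abs ?subr_ge0//.
  apply: le_lt_trans (truncnS_gt _); rewrite intrB.
  have := ceil_ge (- c j - W); rewrite -/(z j); lra.
exists ((j - Num.truncn b) * M + `|x - z j|)%N => /=.
  by rewrite -ltn_divLR// divnMDl// divn_small// addn0.
rewrite /f divnMDl// modnMDl divn_small// modn_small// addn0 subnKC//.
by rewrite gez0_abs ?subr_ge0// subrKC.
Qed.

Lemma counting_band_square (R : realType) (c : nat -> R) (W a b s : R) :
  1 <= s ->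
  (counting (band c W `&` square a b s) <=
    ((3 * (Num.truncn (2 * W)).+1%:R) * s)%:E)%E.
Proof.
move=> s1; apply: le_trans (counting_le R (@card_band_square R c W a b s)) _.
rewrite lee_fin natrM mulrAC ler_wpM2r//.
have : (Num.truncn s)%:R <= s by rewrite truncn_le; lra.
rewrite -!natr1; lra.
Qed.

Lemma counting_le_sub (R : realType) (T : choiceType) (A B : set T) :
  A `<=` B -> (counting A <= counting B :> \bar R)%E.
Proof.
move=> AB; rewrite {2}/counting; case: asboolP => [finB|_]; last by rewrite leey.
apply: counting_le; apply: card_le_trans (subset_card_le AB) _.
have /finite_setP[n Bn] := finB.
by rewrite (card_fset_set Bn) (card_le_eql Bn).
Qed.

(** * Dimension one from two-sided linear bounds *)

(** For [r > 1] the supremum over sides at least [r] is squeezed between 1 and [1 + ln K / ln r]. *)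
Lemma counting_dim_eq1 (R : realType) (F : set (R * R)) (K A : R) :
  1 <= K -> 1 <= A ->
  (forall a b s, 1 <= s -> (counting (F `&` square a b s) <= (K * s)%:E)%E) ->
  (forall n : nat, exists a b,
     ((n.+1%:R : R)%:E <= counting (F `&` square a b (A * n.+1%:R)))%E) ->
  counting_dim F = 1%:E.
Proof.
move=> K1 A1 ub lb.
have lnK0 : 0 <= ln K by exact: ln_ge0.
have cvgV : (1 + ln K / ln r) @[r --> +oo] --> (1 : R).
  rewrite -[X in _ --> X]addr0; apply: cvgD; first exact: cvg_cst.
  rewrite -[X in _ --> X](mulr0 (ln K)); apply: cvgM; first exact: cvg_cst.
  apply/gtr0_cvgV0.
    by apply: filterS (nbhs_pinfty_gt (num_real 1)) => r; exact: ln_gt0.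
  apply/cvgryPge => B.
  apply: filterS (nbhs_pinfty_ge (num_real (expR B))) => r Br.
  by rewrite -(expRK B) ler_ln ?posrE ?expR_gt0// (lt_le_trans (expR_gt0 B)).
apply/cvg_lim => //; apply: (@squeeze_cvge _ _ _ _ (cst 1%:E) _
    (fun r => (1 + ln K / ln r)%:E)); last 2 first.
- exact: cvg_cst.
- by apply: cvg_EFin => /=; [exact: filterE | exact: cvgV].
apply: filterS (nbhs_pinfty_gt (num_real 1)) => r r1.
have ratioE (x : \bar R) (s : R) : 1 < s ->
    (lne x / (ln s)%:E = lne x * ((ln s)^-1)%:E)%E.
  by move=> s1; rewrite inver gt_eqF// ln_gt0.
apply/andP; split.
  apply/lee_addgt0Pr => e e0.
  (* The term [r] makes the side admissible; the exponential gives [ln A <= e * ln s], so the loss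
     from [A] is at most [e]. *)
  pose n := Num.truncn (r + expR (ln A / e)).
  have nP : r + expR (ln A / e) < n.+1%:R by exact: truncnS_gt.
  have eA0 := expR_gt0 (ln A / e).
  have [a [b ab]] := lb n.
  set s := A * n.+1%:R in ab.
  have n0 : 0 < n.+1%:R :> R by [].
  have ns : n.+1%:R <= s by rewrite ler_peMl// ltW.
  have rs : r < s by lra.
  have s1 : 1 < s by lra.
  have lns : 0 < ln s by rewrite ln_gt0.
  have h : (1%:E <= log_count_ratio F a b s + e%:E)%E.
    rewrite /log_count_ratio ratioE//.
    have : (lne n.+1%:R%:E * ((ln s)^-1)%:E <=
            lne (counting (F `&` square a b s)) * ((ln s)^-1)%:E)%E.
      apply: lee_wpmul2r; first by rewrite lee_fin invr_ge0 ltW.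
      by rewrite lee_lne// in_itv/= leey andbT ?lee_fin// (le_trans _ ab)// lee_fin.
    move=> /(leeD2r e%:E) h1; apply: (le_trans _ h1).
    rewrite (lne_EFin n0) -EFinM -EFinD lee_fin.
    have lnsE : ln s = ln A + ln n.+1%:R by rewrite lnM ?posrE//; lra.
    have hA : ln A <= e * ln s.
      rewrite mulrC -ler_pdivrMr// -(expRK (ln A / e)) ler_ln ?posrE//; lra.
    rewrite -(ler_pM2r lns) mulrDl mulfVK ?gt_eqF// mul1r; lra.
  apply: le_trans h _; apply: leeD2r; apply: ereal_sup_ubound.
  by exists (a, b, s) => //=; exact: ltW.
apply: ge_ereal_sup => _ [[[a b] s] /= rs <-].
have s1 : 1 < s by lra.
have lns : 0 < ln s by rewrite ln_gt0.
rewrite /log_count_ratio ratioE//.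
have : (lne (counting (F `&` square a b s)) * ((ln s)^-1)%:E <=
        lne (K * s)%:E * ((ln s)^-1)%:E)%E.
  apply: lee_wpmul2r; first by rewrite lee_fin invr_ge0 ltW.
  have c0 : (0 <= counting (F `&` square a b s) :> \bar R)%E.
    by apply: (@counting_ge R _ _ 0); rewrite II0 card_ge0.
  have Ks : 0 <= K * s by rewrite mulr_ge0//; lra.
  by rewrite lee_lne ?in_itv/= ?leey ?andbT ?lee_fin// ub// ltW.
move=> /le_trans; apply.
rewrite lne_EFin; last by rewrite mulr_gt0//; lra.
rewrite -EFinM lee_fin lnM ?posrE; [|lra|lra].
rewrite mulrDl mulfV ?gt_eqF// addrC lerD2l ler_wpM2l//.
by rewrite lef_pV2 ?posrE ?ln_gt0// ler_ln ?posrE//; lra.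
Qed.

(** * The band around the oscillating curve *)

Theorem theorem5 (R : realType) (eps : R) (heps : 0 < eps) :
  exists E : set (R * R), E `<=` Zsq R /\
    forall u v : R, - eps < u < eps -> - eps < v < eps ->
      counting_dim (E `&` tube u v) = counting_dim E /\
      counting_dim E = 1%:E.
Proof.
pose c (j : nat) : R := j%:R * (eps * sin (ln (ln j%:R))).
(* [W0] bounds the distance from the chosen tube point to [- j * u], and [2 * eps] that from
   [- j * u] to the curve. In [A], the 1 accounts for the height of the run of rows and the rest for
   its horizontal spread. *)
pose W0 := (eps + 1) * (1 + eps).
pose W := W0 + 2 * eps.
pose A := 1 + 2 * eps + 2 * W0.
pose K : R := 3 * (Num.truncn (2 * W)).+1%:R.
have W00 : 0 < W0 by rewrite mulr_gt0//; lra.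
have A1 : 1 <= A by rewrite /A; lra.
have K1 : 1 <= K by rewrite /K -natr1; have := ler0n R (Num.truncn (2 * W)); lra.
exists (band c W); split; first exact: band_Zsq.
have lb u v : - eps < u < eps -> - eps < v < eps -> forall n : nat, exists a b,
    ((n.+1%:R : R)%:E <=
     counting ((band c W `&` tube u v) `&` square a b (A * n.+1%:R)))%E.
  move=> hu hv n; have [m mP] := slow_sin_near n.+1 hu.
  have /choice[x xP] := fun i : nat => tube_int_row u v (m + i)%:R.
  have {}xP i : tube u v ((x i)%:~R, (m + i)%:R) /\
      `|(x i)%:~R + (m + i)%:R * u| <= W0.
    have [? h] := xP i; split => //; apply: le_trans h _.
    apply: ler_pM; rewrite ?addr_ge0// ?lerD2r ?lerD2l.
      by rewrite ltW// ltr_norml.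
    by rewrite ltW// ltr_norml.
  (* Over the run, [- (m + i) * u] stays within [eps * n.+1] of [- m * u], and the tube points
     within a further [W0]. *)
  exists (- (m%:R * u) - eps * n.+1%:R - W0), m%:R.
  apply: counting_ge.
  pose f i : R * R := ((x i)%:~R, (m + i)%:R).
  have finj : {in `I_n.+1 &, injective f}.
    by move=> i j _ _ [_ /eqP]; rewrite eqr_nat eqn_add2l => /eqP.
  rewrite -(card_le_eql (inj_card_eq finj)); apply: subset_card_le.
  move=> _ [i /= in1 <-].
  have [tui] := xP i; rewrite ler_norml => /andP[x1 x2].
  have := mP (m + i)%N; rewrite leq_addr leq_add2l (ltnW in1) => /(_ isT).
  rewrite -/(c _) ler_norml => /andP[c1 c2].
  have iu : `|i%:R * u| <= eps * n.+1%:R.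
    rewrite normrM ger0_norm// mulrC; apply: ler_pM => //.
      by rewrite ltW// ltr_norml.
    by rewrite ler_nat ltnW.
  move: iu; rewrite ler_norml => /andP[iu1 iu2].
  have n1 : (1 : R) <= n.+1%:R by rewrite ler1n.
  have i1 : (i%:R : R) <= n.+1%:R by rewrite ler_nat ltnW.
  have epsn : 0 <= eps * n.+1%:R by rewrite mulr_ge0// ltW.
  have Wn : W0 <= W0 * n.+1%:R by rewrite ler_peMr// ltW.
  have muE : (m + i)%:R * u = m%:R * u + i%:R * u by rewrite natrD mulrDl.
  have AE : A * n.+1%:R = n.+1%:R + 2 * (eps * n.+1%:R) + 2 * (W0 * n.+1%:R).
    by rewrite /A; ring.
  have i0 : 0 <= i%:R :> R by [].
  split; first split => //.
    exists (x i), (m + i)%N; split => //.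
    rewrite /W ler_norml; apply/andP; split; lra.
  rewrite /square /f /= AE natrD; split; apply/andP; split; lra.
have ub F : F `<=` band c W -> forall a b s, 1 <= s ->
    (counting (F `&` square a b s) <= (K * s)%:E)%E.
  move=> FE a b s s1; apply: le_trans (counting_band_square c W a b s1).
  by apply: counting_le_sub => p [/FE].
have dimT u v : - eps < u < eps -> - eps < v < eps ->
    counting_dim (band c W `&` tube u v) = 1%:E.
  move=> hu hv; apply: (counting_dim_eq1 K1 A1); last exact: lb.
  by apply: ub => p [].
have dimE : counting_dim (band c W) = 1%:E.
  apply: (counting_dim_eq1 K1 A1); first exact: ub.
  (* The part of the band in the tube with [u = v = 0] already supplies the lower bound. *)
  have h0 : - eps < 0 < eps by rewrite oppr_lt0 heps.
  move=> n; have [a [b ab]] := lb 0 0 h0 h0 n; exists a, b.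
  by apply: le_trans ab _; apply: counting_le_sub => p [[]].
by move=> u v hu hv; rewrite dimT.
Qed.
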